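(* Consider the $2$-parameter family of almost Abelian Lie algebras $(\mathfrak g,A)$ with $$A=A_{x,y}=\begin{pmatrix}B&0\\ 0&-B^t\end{pmatrix},\qquad B=\begin{pmatrix}0&x&0\\ y&0&0\\ 0&0&0\end{pmatrix},\qquad x,y\in\mathbb R .$$ Then the bracket flow $$\frac{d}{dt}A=-\Big(\tfrac12\operatorname{tr}(S_A^2)+\tfrac14(\operatorname{tr}JA)^2\Big)A+\tfrac12[A,[A,A^t]]+\tfrac12[A,S_A\circ_6S_A]$$ on this family is stable, i.e. every equilibrium point $(x_0,y_0)\in\mathbb R^2$ of the planar system for $(x(t),y(t))$ it induces is (Lyapunov) stable.
   Context: The almost Abelian Lie algebra $(\mathfrak g,A)$ is $\mathbb R^7=\mathbb R^6\oplus\mathbb Re_7$ with $\mathbb R^6=\mathrm{span}(e_1,\dots,e_6)$ an Abelian ideal and $\mathrm{ad}(e_7)|_{\mathbb R^6}=A$. It carries the $\mathrm G_2$-structure $\varphi=\omega\wedge e^7+\rho^+$ with $e_1,\dots,e_7$ orthonormal, and here (for the block form of $A$) $\omega=e^{14}+e^{25}+e^{36}$, $\rho^+=e^{123}-e^{156}+e^{246}-e^{345}$; $J$ is the complex structure on $\mathbb R^6$ with $\omega=\langle J\cdot,\cdot\rangle$. With this choice $A_{x,y}\in\mathfrak{sp}(\mathbb R^6)=\{A:AJ+JA^t=0\}$, i.e. $\varphi$ is coclosed. Notation: $S_A=\frac12(A+A^t)$ and $(S\circ_6S)_{ab}=S_{mn}S_{pq}\rho^+_{mpa}\rho^+_{nqb}$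 (sum over repeated indices $1,\dots,6$). The family $\{A_{x,y}\}$ is preserved by the ODE, which is the bracket-flow form of the Laplacian coflow of coclosed $\mathrm G_2$-structures. *)

(* Defs.v *)
From HB Require Import structures.
From mathcomp Require Import all_boot all_order all_algebra.
From mathcomp Require Import all_classical all_reals all_analysis.
From mathcomp Require Import ring.

Set Implicit Arguments.
Unset Strict Implicit.
Unset Printing Implicit Defensive.

Import Order.TTheory GRing.Theory Num.Theory.
Import numFieldNormedType.Exports.

Local Open Scope classical_set_scope.
Local Open Scope ring_scope.

(* [coframe R s a] is the component e^{s_1...s_k}(e_{a_1},...,e_{a_k}) of the
   wedge product of the dual basis covectors e^{s_1}, ..., e^{s_k}, that is, a
   determinant of Kronecker symbols. *)
Definition coframe (R : realType) (s a : seq nat) : R :=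
  \det (\matrix_(i < size s, j < size s) (nth 0 s i == nth 0 a j)%:R).

(* An index i : 'I_6 stands for the basis vector e_{i+1}. *)
Definition omega (R : realType) (i j : 'I_6) : R :=
  let v := [:: i.+1; j.+1] in
  coframe R [:: 1; 4]%N v + coframe R [:: 2; 5]%N v + coframe R [:: 3; 6]%N v.

Definition rho_plus (R : realType) (i j k : 'I_6) : R :=
  let v := [:: i.+1; j.+1; k.+1] in
  coframe R [:: 1; 2; 3]%N v - coframe R [:: 1; 5; 6]%N v
  + coframe R [:: 2; 4; 6]%N v - coframe R [:: 3; 4; 5]%N v.

(* Matrices act on column vectors, so omega = <J., .> reads
   J i j = <J e_j, e_i> = omega(e_j, e_i). *)
Definition Jmx (R : realType) : 'M[R]_6 := \matrix_(i, j) omega R j i.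

Definition lie_bracket (R : realType) (X Y : 'M[R]_6) : 'M[R]_6 :=
  X *m Y - Y *m X.

Definition sympart (R : realType) (X : 'M[R]_6) : 'M[R]_6 :=
  2^-1 *: (X + X^T).

Definition circ6 (R : realType) (S T : 'M[R]_6) : 'M[R]_6 :=
  \matrix_(a, b) \sum_(m < 6) \sum_(n < 6) \sum_(p < 6) \sum_(q < 6)
    S m n * T p q * rho_plus R m p a * rho_plus R n q b.

Definition bracket_field (R : realType) (A : 'M[R]_6) : 'M[R]_6 :=
  let S := sympart A in
  - (2^-1 * \tr (S *m S) + 4^-1 * (\tr (Jmx R *m A)) ^+ 2) *: A
  + 2^-1 *: lie_bracket A (lie_bracket A A^T)
  + 2^-1 *: lie_bracket A (circ6 S S).

Definition Bmx (R : realType) (x y : R) : 'M[R]_3 :=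
  \matrix_(i, j) if (i == 0 :> nat) && (j == 1 :> nat) then x
                 else if (i == 1 :> nat) && (j == 0 :> nat) then y else 0.

Definition Amx (R : realType) (p : R * R) : 'M[R]_6 :=
  let B := Bmx p.1 p.2 in block_mx B 0 0 (- B^T).

(* The entries (1,2) and (2,1) of [Amx (x, y)] are x and y; the lemma
   [bracket_field_Amx] below shows that the other entries of the bracket flow
   are those of a tangent vector to the family. *)
Definition planar_field (R : realType) (p : R * R) : R * R :=
  (bracket_field (Amx p) (inord 0) (inord 1),
   bracket_field (Amx p) (inord 1) (inord 0)).

Lemma coframe_eq0 (R : realType) (s a : seq nat) (k : nat) :
  k \in s -> k \notin a -> size a = size s -> coframe R s a = 0.
Proof.
move=> ks ka sa; rewrite /coframe.
have ik : (index k s < size s)%N by rewrite index_mem.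
rewrite (expand_det_row _ (Ordinal ik)) big1 // => j _; rewrite mxE /=.
rewrite nth_index // (negbTE (_ : k != nth 0%N a j)) ?mul0r //.
apply: contra ka => /eqP ->; rewrite mem_nth // sa.
exact: ltn_ord.
Qed.

Lemma rho_plus_eq0 (R : realType) (i j k : 'I_6) :
  (i %% 3 != 2)%N -> (j %% 3 != 2)%N -> (k %% 3 != 2)%N -> rho_plus R i j k = 0.
Proof.
move=> hi hj hk; rewrite /rho_plus.
have h m : (m %% 3 = 2)%N -> m.+1 \notin [:: i.+1; j.+1; k.+1].
  move=> hm; rewrite !inE !eqSS; apply/negP => /or3P[] /eqP e;
  by move: hi hj hk; rewrite -e hm.
rewrite (@coframe_eq0 _ [:: 1; 2; 3]%N _ 3) // ?h //.
rewrite (@coframe_eq0 _ [:: 1; 5; 6]%N _ 6) // ?h //.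
rewrite (@coframe_eq0 _ [:: 2; 4; 6]%N _ 6) // ?h //.
rewrite (@coframe_eq0 _ [:: 3; 4; 5]%N _ 3) // ?h //.
by rewrite !subr0 addr0.
Qed.

Lemma AmxE (R : realType) (p : R * R) (i j : 'I_6) :
  Amx p i j = match nat_of_ord i, nat_of_ord j with
              | 0, 1 => p.1 | 1, 0 => p.2 | 3, 4 => (- p.2)%R | 4, 3 => (- p.1)%R
              | _, _ => 0%R end%N.
Proof.
move: i j; change 'I_6 with 'I_(3 + 3) => i j.
rewrite /Amx; set B := Bmx _ _.
case: (split_ordP i) => i' ->; case: (split_ordP j) => j' ->;
  rewrite ?(block_mxEul B 0 0) ?(block_mxEur B 0 0) ?(block_mxEdl B 0 0)
          ?(block_mxEdr B 0 0) !mxE /=;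
  case: i' => [[|[|[|?]]] ?] //; case: j' => [[|[|[|?]]] ?] //=;
  by rewrite ?oppr0.
Qed.

Lemma Amx_eq0 (R : realType) (p : R * R) (i j : 'I_6) :
  ((i %% 3 == 2) || (j %% 3 == 2))%N -> Amx p i j = 0.
Proof.
by rewrite AmxE; case: i => [[|[|[|[|[|[|?]]]]]] ?] //; case: j => [[|[|[|[|[|[|?]]]]]] ?] //.
Qed.

Lemma sympartE (R : realType) (X : 'M[R]_6) (i j : 'I_6) :
  sympart X i j = 2^-1 * (X i j + X j i).
Proof. by rewrite !mxE. Qed.

Lemma lie_bracketE (R : realType) (X Y : 'M[R]_6) (i j : 'I_6) :
  lie_bracket X Y i j = \sum_k X i k * Y k j - \sum_k Y i k * X k j.
Proof. by rewrite !mxE. Qed.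

Lemma sympart_Amx_eq0 (R : realType) (p : R * R) (i j : 'I_6) :
  ((i %% 3 == 2) || (j %% 3 == 2))%N -> sympart (Amx p) i j = 0.
Proof. by move=> h; rewrite sympartE !Amx_eq0 ?addr0 ?mulr0 // orbC. Qed.

Lemma circ6_Amx_eq0 (R : realType) (p : R * R) (a b : 'I_6) :
  (a %% 3 != 2)%N || (b %% 3 != 2)%N ->
  circ6 (sympart (Amx p)) (sympart (Amx p)) a b = 0.
Proof.
move=> hab; rewrite mxE.
apply: big1 => m _; apply: big1 => n _; apply: big1 => k _; apply: big1 => l _.
have [h|] := boolP ((m %% 3 == 2) || (n %% 3 == 2))%N.
  by rewrite (sympart_Amx_eq0 _ h) !mul0r.
rewrite negb_or => /andP[hm hn].
have [h|] := boolP ((k %% 3 == 2) || (l %% 3 == 2))%N.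
  by rewrite (sympart_Amx_eq0 _ h) !(mulr0, mul0r).
rewrite negb_or => /andP[hk hl]; case/orP: hab => h.
- by rewrite (rho_plus_eq0 R hm hk h) !(mulr0, mul0r).
- by rewrite (rho_plus_eq0 R hn hl h) !(mulr0, mul0r).
Qed.

Lemma lie_bracket_circ6_Amx (R : realType) (p : R * R) :
  lie_bracket (Amx p) (circ6 (sympart (Amx p)) (sympart (Amx p))) = 0.
Proof.
apply/matrixP => i j; rewrite lie_bracketE mxE !big1 ?subr0 // => k _.
- have [h|h] := boolP (k %% 3 == 2)%N.
    by rewrite [X in _ * X]Amx_eq0 ?h ?mulr0.
  by rewrite [X in X * _]circ6_Amx_eq0 ?h ?orbT ?mul0r.
- have [h|h] := boolP (k %% 3 == 2)%N.
    by rewrite [X in X * _]Amx_eq0 ?h ?orbT ?mul0r.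
  by rewrite [X in _ * X]circ6_Amx_eq0 ?h ?mulr0.
Qed.

Lemma tr_Jmx_Amx (R : realType) (p : R * R) : \tr (Jmx R *m Amx p) = 0.
Proof.
rewrite /mxtrace big1 // => i _; rewrite mxE big1 // => j _.
have [e|ne] := boolP (i %% 3 == j %% 3)%N.
  rewrite [X in _ * X](_ : _ = 0) ?mulr0 // AmxE; move: e.
  by case: i => [[|[|[|[|[|[|?]]]]]] ?] //; case: j => [[|[|[|[|[|[|?]]]]]] ?] //.
rewrite mxE /omega (_ : _ + _ = 0) ?mul0r //.
have h k : (k < 3)%N -> coframe R [:: k.+1; k.+4]%N [:: j.+1; i.+1] = 0.
  move=> k3.
  have [|] := boolP (k.+1 \in [:: j.+1; i.+1]) => h1; last first.
    by apply: (@coframe_eq0 _ _ _ k.+1); rewrite // mem_head.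
  apply: (@coframe_eq0 _ _ _ k.+4); rewrite // ?inE ?eqxx ?orbT //.
  apply: contra ne => h2; move: h1 h2; rewrite !inE !eqSS.
  have e3 : k.+3 = (k + 3)%N by rewrite addn3.
  move=> /orP[]/eqP e1 /orP[]/eqP e2; rewrite -?e1 -?e2 ?e3 ?modnDr //.
  - by move: e2; rewrite -e1 => /eqP; rewrite e3 -[X in _ == X]addn0 eqn_add2l.
  - by move: e2; rewrite -e1 => /eqP; rewrite e3 -[X in _ == X]addn0 eqn_add2l.
by rewrite !h // !addr0.
Qed.

Lemma bracket_field_Amx_explicit (R : realType) (x y : R) :
  bracket_field (Amx (x, y)) =
  Amx (- (2^-1 * (x + y) ^+ 2 + x ^+ 2 - y ^+ 2) * x,
       - (2^-1 * (x + y) ^+ 2 - x ^+ 2 + y ^+ 2) * y).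
Proof.
rewrite /bracket_field lie_bracket_circ6_Amx scaler0 addr0 tr_Jmx_Amx.
rewrite expr0n mulr0 addr0.
set A := Amx (x, y).
have AE i j : A i j = _ := AmxE (x, y) i j; rewrite /= in AE; clearbody A.
have -> : \tr (sympart A *m sympart A) = (x + y) ^+ 2.
  rewrite /mxtrace; under eq_bigr do rewrite mxE.
  by rewrite !big_ord_recl !big_ord0 !sympartE !AE /=; field.
pose D : 'rV[R]_6 := \row_i match nat_of_ord i with
  | 0 | 4 => (x ^+ 2 - y ^+ 2)%R | 1 | 3 => (y ^+ 2 - x ^+ 2)%R
  | _ => 0%R end%N.
have -> : lie_bracket A A^T = diag_mx D.
  apply/matrixP => i j; rewrite lie_bracketE.
  rewrite !big_ord_recl !big_ord0 !mxE !AE /= {AE}.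
  case: i => [[|[|[|[|[|[|?]]]]]] ?] //; case: j => [[|[|[|[|[|[|?]]]]]] ?] //=;
  by rewrite ?mulr0n ?mulr1n; ring.
apply/matrixP => i j; rewrite /lie_bracket mul_mx_diag mul_diag_mx.
rewrite AmxE /=.
rewrite !mxE !AE /= {AE}.
case: i => [[|[|[|[|[|[|?]]]]]] ?] //; case: j => [[|[|[|[|[|[|?]]]]]] ?] //=;
by field.
Qed.

(* The family is preserved by the bracket flow, and [planar_field] is the planar
   system it induces. *)
Lemma bracket_field_Amx (R : realType) (p : R * R) :
  bracket_field (Amx p) = Amx (planar_field p).
Proof.
case: p => x y; rewrite /planar_field bracket_field_Amx_explicit.
by apply/matrixP => i j; rewrite !AmxE !inordK.
Qed.

(* Solutions of z' = f(z) on [0, T[, with 0 < T <= +oo; at the end point 0 only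
   continuity from the right is required. *)
Definition forward_solution (R : realType) (V : normedModType R) (f : V -> V)
    (T : \bar R) (z : R -> V) : Prop :=
  {within [set t : R | 0 <= t /\ (t%:E < T)%E], continuous z} /\
  forall t : R, 0 < t -> (t%:E < T)%E -> is_derive t 1 z (f (z t)).

(* Solutions starting close to p exist for all positive times, and all solutions
   starting there, global or not, remain close to p. *)
Definition lyapunov_stable (R : realType) (V : normedModType R) (f : V -> V)
    (p : V) : Prop :=
  forall eps : R, 0 < eps -> exists2 delta : R, 0 < delta &
    forall q : V, `|q - p| < delta ->
      (exists2 z : R -> V, z 0 = q & forward_solution f +oo%E z) /\
      (forall (T : \bar R) (z : R -> V), z 0 = q -> forward_solution f T z ->
        forall t : R, 0 <= t -> (t%:E < T)%E -> `|z t - p| < eps).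

(* Main.v *)
Require Import Defs.
From HB Require Import structures.
From mathcomp Require Import all_boot all_order all_algebra.
From mathcomp Require Import all_classical all_reals all_analysis.
From mathcomp Require Import ring lra.

Set Implicit Arguments.
Unset Strict Implicit.

Import Order.TTheory GRing.Theory Num.Theory.
Import numFieldNormedType.Exports.
Local Open Scope classical_set_scope.
Local Open Scope ring_scope.

(** The planar system is x' = - x (x + y) (3 x - y) / 2 and
    y' = - y (x + y) (3 y - x) / 2, so its equilibria are exactly the points
    of the line x + y = 0.  In the coordinates u = x + y and v = x - y it
    becomes

      u' = - u (u^2 + 2 v^2) / 2,      v' = - 3 u^2 v / 2.

    Stability.  The square of u decreases, and u cannot change sign.  While
    u >= 0, both v + (3/2) u and - v + (3/2) u are nonincreasing, their
    derivatives being - (3/4) u ((u + v)^2 + v^2) and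
    - (3/4) u ((u - v)^2 + v^2).  So the interval with end points
    v - (3/2) u and v + (3/2) u is nested decreasing in time, which gives
    |u(t)| <= |u(0)| and |v(t) - v(0)| <= (3/2) |u(0)| ([sum_diff_trapped]).
    At an equilibrium u = 0, so |u(0)| is at most twice the initial distance,
    and every solution stays within four times its initial distance to the
    equilibrium ([planar_solution_stable]).  The estimate is uniform along the
    line of equilibria, including the origin, where the linearization
    vanishes.

    Global existence.  The ratio of the smaller of u and v to the larger one
    satisfies a Bernoulli equation once time is rescaled by the square of the
    larger one.  This gives every orbit other than the origin as an explicit curve
    y |-> (u(y), v(y)), defined for all real y, which follows the vector field
    divided by a positive function h(y), the larger of u^2 and v^2
    ([orbit_diff_dominant], [orbit_sum_dominant]).  A solution
    of the flow is then this curve composed with a solution of the scalar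
    equation y' = h(y).  That equation is solved for all t >= 0 by inverting
    an antiderivative of 1/h ([autonomous_ode_solvable]): as h is bounded on
    y >= 0, infinite time is needed to reach y = +oo. *)

(** * Scalar autonomous equations *)

Lemma continuous_antiderivative (R : realType) (f : R -> R) (a : R) :
  continuous f ->
  exists F : R -> R, forall x : R, a < x -> is_derive x 1 F (f x).
Proof.
move=> cf; exists (parameterized_integral lebesgue_measure a ^~ f) => x ax.
have xx1 : x < x + 1 by rewrite ltrDl.
have intf : (@lebesgue_measure R).-integrable
    [set` Interval (BLeft a) (BRight (x + 1))] (EFin \o f).
  apply: continuous_compact_integrable; first exact: segment_compact.
  exact: continuous_subspaceT.
have [dF <-] := continuous_FTC1 xx1 intf (a := BLeft a) ax (cf x).
by rewrite derive1E; exact: derivableP.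
Qed.

(** Separation of variables: the solution with y(0) = 0 is the inverse of
    T(y) = \int_0^y 1/h.  The bound on h makes T grow at least linearly, so that
    its range contains [0, +oo[. *)
Lemma autonomous_ode_solvable (R : realType) (h : R -> R) (C : R) :
  continuous h -> (forall y, 0 < h y) -> (forall y, 0 <= y -> h y <= C) ->
  exists2 y : R -> R, y 0 = 0 & forall t : R, 0 <= t -> is_derive t 1 y (h (y t)).
Proof.
move=> ch h0 hC.
have C0 : 0 < C by exact: lt_le_trans (h0 0) (hC 0 (lexx 0)).
have hn0 y : h y != 0 by rewrite gt_eqF.
have cV : continuous (fun y => (h y)^-1) by move=> y; apply: cvgV; [exact: hn0 | exact: ch].
(* Starting the antiderivative at -1 makes 0 an interior point of its domain,
   so the inverse is differentiable at t = 0 and not only from the right. *)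
have [F dF] := @continuous_antiderivative R _ (-1) cV.
have cF y : -1 < y -> {for y, continuous F}.
  move=> /dF [dFy _].
  exact/differentiable_continuous/derivable1_diffP.
have mvtF a b : -1 < a -> a < b ->
    exists2 c, c \in `]a, b[ & F b - F a = (h c)^-1 * (b - a).
  move=> a1 ab; apply: MVT => //.
  - move=> x; rewrite in_itv /= => /andP[ax _]; apply: dF; exact: lt_trans ax.
  - apply: continuous_in_subspaceT => x; rewrite inE /= in_itv /= => /andP[ax _].
    by apply: cF; exact: lt_le_trans ax.
have incF a b : -1 < a -> a < b -> F a < F b.
  move=> a1 ab; have [c _ e] := mvtF a b a1 ab.
  by rewrite -subr_gt0 e mulr_gt0 ?invr_gt0 ?subr_gt0.
have injF a b : -1 < a -> -1 < b -> F a = F b -> a = b.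
  move=> a1 b1 e; case: (ltgtP a b) => // ab.
  - by have := incF _ _ a1 ab; rewrite e ltxx.
  - by have := incF _ _ b1 ab; rewrite e ltxx.
pose T y := F y - F 0.
pose g t := xget 0 [set y | -1 < y /\ T y = t].
have N10 : (-1 : R) < 0 by rewrite oppr_lt0.
have gT y : -1 < y -> g (T y) = y.
  move=> y1; rewrite /g; case: xgetP => [z _ [z1 /subIr e]|/(_ y)].
    exact: injF.
  by case.
have surjT t : 0 <= t -> exists2 y, -1 < y & T y = t.
  rewrite le_eqVlt => /predU1P[<-|t0]; first by exists 0; rewrite // /T subrr.
  have Ct0 : 0 < C * t by exact: mulr_gt0.
  (* T' >= 1/C on [0, C t]. *)
  have tT : t <= T (C * t).
    have [c] := mvtF 0 (C * t) N10 Ct0; rewrite in_itv /= /T => /andP[c0 _] ->.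
    by rewrite subr0 mulrC ler_pdivlMr // mulrC ler_pM2r // hC // ltW.
  have T0 : T 0 = 0 by rewrite /T subrr.
  have [||y] := @IVT R T 0 (C * t) t (ltW Ct0).
  - apply: continuous_in_subspaceT => x; rewrite inE /= in_itv /= => /andP[x0 _].
    apply: cvgB; last exact: cvg_cst.
    by apply: cF; exact: lt_le_trans x0.
  - by rewrite T0 min_l ?max_r ?(ltW t0) // (le_trans (ltW t0) tT).
  - rewrite in_itv /= => /andP[y0 _] Ty; exists y => //.
    exact: lt_le_trans y0.
exists g; first by rewrite -[in LHS](subrr (F 0)) -/(T 0) gT.
move=> t t0; have [y y1 <-] := surjT t t0.
have nearN1 : \forall z \near y, -1 < z by exact: lt_nbhsr.
rewrite gT // -[h y]invrK; apply: is_derive_inverse.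
- by near=> z; apply: gT; near: z.
- near=> z; apply: cvgB; last exact: cvg_cst.
  by apply: cF; near: z.
- have dT : is_derive y 1 (F - cst (F 0)) ((h y)^-1 - 0).
    by apply: is_deriveB; exact: dF.
  by rewrite subr0 in dT.
- by rewrite invr_eq0.
Unshelve. all: by end_near. Qed.

(** * Derivatives of plane curves, componentwise *)

Lemma is_derive_fst (R : realType) (z : R -> R * R) (t : R) (d : R * R) :
  is_derive t 1 z d -> is_derive t 1 (fst \o z) d.1.
Proof.
move=> [dz ed]; have := dz; rewrite /derivable -/(derive z t 1) => zd.
have cz : (fun h : R => h^-1 *: ((z \o shift t) (h *: 1) - z t)) @ 0^' --> d.
  by rewrite -ed.
have cfst : fst x @[x --> d] --> d.1 by case: d {ed cz} => a b; exact: cvg_fst.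
have cz1 := cvg_comp _ _ cz cfst.
have c1 : (fun h : R => h^-1 *: (((fst \o z) \o shift t) (h *: 1) - (fst \o z) t))
    @ 0^' --> d.1 by exact: cz1.
by split; [apply/cvg_ex; exists d.1 | apply/cvg_lim; first exact: Rhausdorff].
Qed.

Lemma is_derive_snd (R : realType) (z : R -> R * R) (t : R) (d : R * R) :
  is_derive t 1 z d -> is_derive t 1 (snd \o z) d.2.
Proof.
move=> [dz ed]; have := dz; rewrite /derivable -/(derive z t 1) => zd.
have cz : (fun h : R => h^-1 *: ((z \o shift t) (h *: 1) - z t)) @ 0^' --> d.
  by rewrite -ed.
have csnd : snd x @[x --> d] --> d.2 by case: d {ed cz} => a b; exact: cvg_snd.
have cz1 := cvg_comp _ _ cz csnd.
have c1 : (fun h : R => h^-1 *: (((snd \o z) \o shift t) (h *: 1) - (snd \o z) t))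
    @ 0^' --> d.2 by exact: cz1.
by split; [apply/cvg_ex; exists d.2 | apply/cvg_lim; first exact: Rhausdorff].
Qed.

Lemma is_derive_pair (R : realType) (f g : R -> R) (t df dg : R) :
  is_derive t 1 f df -> is_derive t 1 g dg ->
  is_derive t 1 (fun s => (f s, g s)) (df, dg).
Proof.
move=> [cf ef] [cg eg].
have {}cf : (fun h : R => h^-1 *: ((f \o shift t) (h *: 1) - f t)) @ 0^' --> df.
  by rewrite -ef.
have {}cg : (fun h : R => h^-1 *: ((g \o shift t) (h *: 1) - g t)) @ 0^' --> dg.
  by rewrite -eg.
have c := cvg_pair cf cg.
split; first by apply/cvg_ex; exists (df, dg); exact: c.
by apply/cvg_lim => //; exact: c.
Qed.

(** * The system in the coordinates u = x + y and v = x - y *)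

Lemma planar_fieldE (R : realType) (x y : R) :
  planar_field (x, y) =
  (- (x * (x + y) * (3 * x - y) / 2), - (y * (x + y) * (3 * y - x) / 2)).
Proof.
rewrite /planar_field bracket_field_Amx_explicit !AmxE !inordK //=.
by congr pair; field.
Qed.

Lemma planar_field_eq0 (R : realType) (p : R * R) :
  planar_field p = 0 -> p.1 + p.2 = 0.
Proof.
case: p => x y /=; rewrite planar_fieldE => -[/eqP ex /eqP ey].
apply/eqP; apply: contraT => s0.
move: ex ey; rewrite !oppr_eq0 !mulf_eq0 (negbTE s0) !invr_eq0 !pnatr_eq0 /=.
rewrite !orbF => /orP[/eqP x0|/eqP ex] /orP[/eqP y0|/eqP ey];
  by move/eqP: s0; case; lra.
Qed.

Lemma nonincreasing_is_derive (R : realType) (f df : R -> R) (a b : R) :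
  a <= b -> {within `[a, b], continuous f} ->
  (forall s : R, a < s < b -> is_derive s 1 f (df s)) ->
  (forall s : R, a < s < b -> df s <= 0) -> f b <= f a.
Proof.
rewrite le_eqVlt => /predU1P[-> //|ab] cf dfE df0.
have [s sab e] : exists2 c, c \in `]a, b[ & f b - f a = df c * (b - a).
  by apply: MVT => // s; rewrite in_itv /=; exact: dfE.
by rewrite -subr_le0 e mulr_le0_ge0 ?df0 ?subr_ge0 ?(ltW ab).
Qed.

(** The time interval [0, t] is closed and the solution is only continuous at
    its ends: this is what a solution on [0, T[ gives on [0, t] for t < T. *)
Definition sum_diff_solution (R : realType) (u v : R -> R) (t : R) :=
  [/\ {within `[0, t], continuous u}, {within `[0, t], continuous v} &
   forall s : R, 0 < s < t ->
     is_derive s 1 u (- (u s * (u s ^+ 2 + 2 * v s ^+ 2) / 2)) /\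
     is_derive s 1 v (- (3 / 2 * u s ^+ 2 * v s))].

Lemma sum_diff_solution_oppl (R : realType) (u v : R -> R) (t : R) :
  sum_diff_solution u v t -> sum_diff_solution (- u) v t.
Proof.
move=> [cu cv d]; split=> //.
  by move=> x; apply: continuousN; exact: cu.
move=> s st; have [du dv] := d s st; split.
  apply: is_derive_eq; rewrite /= !fctE; ring.
by rewrite fctE sqrrN.
Qed.

Lemma sum_diff_solution_oppr (R : realType) (u v : R -> R) (t : R) :
  sum_diff_solution u v t -> sum_diff_solution u (- v) t.
Proof.
move=> [cu cv d]; split=> //.
  by move=> x; apply: continuousN; exact: cv.
move=> s st; have [du dv] := d s st; split; first by rewrite fctE sqrrN.
by apply: is_derive_eq; rewrite /= !fctE; ring.
Qed.

Lemma sum_diff_solution_le (R : realType) (u v : R -> R) (s t : R) :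
  s <= t -> sum_diff_solution u v t -> sum_diff_solution u v s.
Proof.
move=> st [cu cv d].
have sub : `[0, s] `<=` `[0, t] by apply/subset_itv; rewrite bnd_simp.
split; [exact: continuous_subspaceW cu|exact: continuous_subspaceW cv|].
by move=> r /andP[r0 rs]; apply: d; rewrite r0 (lt_le_trans rs).
Qed.

Lemma sum_sqr_nonincreasing (R : realType) (u v : R -> R) (a t : R) :
  sum_diff_solution u v t -> 0 <= a <= t -> u t * u t <= u a * u a.
Proof.
move=> [cu cv d] /andP[a0 at_].
pose df s := - (u s ^+ 2 * (u s ^+ 2 + 2 * v s ^+ 2)).
apply: (@nonincreasing_is_derive _ (u * u) df) => //.
- have sub : `[a, t] `<=` `[0, t] by apply/subset_itv; rewrite bnd_simp.
  have {}cu := continuous_subspaceW sub cu.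
  by move=> x; apply: continuousM; exact: cu.
- move=> s /andP[as_ st]; have [|du _] := d s; first by rewrite st (le_lt_trans a0).
  by apply: is_derive_eq; rewrite /df /GRing.scale /=; field.
- move=> s _; rewrite oppr_le0 mulr_ge0 ?addr_ge0 ?sqr_ge0 //.
  by rewrite mulr_ge0 ?sqr_ge0.
Qed.

(** A sign change would force u to vanish at some time, after which the
    nonincreasing square u^2 stays equal to 0. *)
Lemma sum_ge0 (R : realType) (u v : R -> R) (t : R) :
  sum_diff_solution u v t -> 0 <= t -> 0 <= u 0 -> 0 <= u t.
Proof.
move=> sol t0 u0; rewrite leNgt; apply/negP => ut.
have [cu _ _] := sol.
have [|s] := IVT t0 cu (v := 0).
  by rewrite min_r ?max_l ?u0 ?(ltW ut) // (le_trans (ltW ut)).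
rewrite in_itv /= => s0t us.
have := sum_sqr_nonincreasing sol s0t.
by rewrite us mul0r leNgt nmulr_rgt0 ?ut.
Qed.

(** The slope 3/2 turns the quadratic factor of the derivative into a sum of
    squares: (3/2) u v + (3/4) (u^2 + 2 v^2) = (3/4) ((u + v)^2 + v^2). *)
Lemma sum_diff_nonincreasing (R : realType) (u v : R -> R) (t : R) :
  sum_diff_solution u v t -> 0 <= t -> 0 <= u 0 ->
  v t + 3 / 2 * u t <= v 0 + 3 / 2 * u 0.
Proof.
move=> sol t0 u0; have [cu cv d] := sol.
pose df s := - (3 / 4 * u s * ((u s + v s) ^+ 2 + v s ^+ 2)).
apply: (@nonincreasing_is_derive _ (v + (3 / 2 : R) \*: u) df) => //.
- move=> x; apply: continuousD; first exact: cv.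
  by apply: continuousZr; exact: cu.
- move=> s st; have [du dv] := d s st.
  by apply: is_derive_eq; rewrite /df /GRing.scale /=; field.
- move=> s /andP[/ltW s0 /ltW st]; rewrite oppr_le0 mulr_ge0 //.
    by rewrite mulr_ge0 // (sum_ge0 (sum_diff_solution_le st sol)).
  by rewrite addr_ge0 ?sqr_ge0.
Qed.

(** The lower bound on v comes from [sum_diff_nonincreasing] applied to (u, - v),
    and the case u(0) < 0 from the solution (- u, v). *)
Lemma sum_diff_trapped (R : realType) (u v : R -> R) (t : R) :
  sum_diff_solution u v t -> 0 <= t ->
  `|u t| <= `|u 0| /\ `|v t - v 0| <= 3 / 2 * `|u 0|.
Proof.
move=> sol t0; wlog u0 : u sol / 0 <= u 0 => [ih|].
  have [/ih|/ltW u0] := leP 0 (u 0); first exact.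
  have := ih _ (sum_diff_solution_oppl sol); rewrite !fctE !normrN; apply.
  by rewrite oppr_ge0.
have ut := sum_ge0 sol t0 u0.
have uu : u t <= u 0.
  have := sum_sqr_nonincreasing (a := 0) sol; rewrite lexx t0 => /(_ isT).
  by rewrite -!expr2 ler_sqr.
have w1 := sum_diff_nonincreasing sol t0 u0.
have w2 := sum_diff_nonincreasing (sum_diff_solution_oppr sol) t0 u0.
rewrite !fctE in w2; rewrite (ger0_norm u0) (ger0_norm ut); split=> //.
by rewrite ler_norml; apply/andP; split; lra.
Qed.

Lemma planar_solution_sum_diff (R : realType) (T : \bar R) (z : R -> R * R)
    (t : R) : forward_solution (@planar_field R) T z -> (t%:E < T)%E ->
  sum_diff_solution (fun s => (z s).1 + (z s).2) (fun s => (z s).1 - (z s).2) t.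
Proof.
move=> [cz dz] tT.
have sub : `[0, t] `<=` [set s : R | 0 <= s /\ (s%:E < T)%E].
  move=> s /=; rewrite in_itv /= => /andP[s0 st]; split=> //.
  by apply: le_lt_trans tT; rewrite lee_fin.
have {}cz := continuous_subspaceW sub cz.
have cz1 : {within `[0, t], continuous (fst \o z)}.
  by move=> x; apply: (cvg_comp _ _ (cz x)); case: (z x) => a b; exact: cvg_fst.
have cz2 : {within `[0, t], continuous (snd \o z)}.
  by move=> x; apply: (cvg_comp _ _ (cz x)); case: (z x) => a b; exact: cvg_snd.
split.
- have : {within `[0, t], continuous ((fst \o z) + (snd \o z))}.
    by move=> x; apply: continuousD; [exact: cz1|exact: cz2].
  by [].
- have : {within `[0, t], continuous ((fst \o z) - (snd \o z))}.
    by move=> x; apply: continuousB; [exact: cz1|exact: cz2].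
  by [].
move=> s /andP[s0 st].
have sT : (s%:E < T)%E by apply: lt_trans tT; rewrite lte_fin.
have d := dz s s0 sT.
have d1 := is_derive_fst d; have d2 := is_derive_snd d.
rewrite [z s]surjective_pairing planar_fieldE /= in d1 d2.
split.
- by apply: (is_derive_eq (is_deriveD d1 d2)); field.
- by apply: (is_derive_eq (is_deriveB d1 d2)); field.
Qed.

(** With d the initial distance, |u(0)| <= 2 d since u vanishes at p, so v moves
    by at most 3 d; then x and y move by at most 4 d from p. *)
Lemma planar_solution_stable (R : realType) (p : R * R) (T : \bar R)
    (z : R -> R * R) (t : R) :
  planar_field p = 0 -> forward_solution (@planar_field R) T z ->
  0 <= t -> (t%:E < T)%E -> `|z t - p| <= 4 * `|z 0 - p|.
Proof.
move=> /planar_field_eq0 p0 sol t0 tT.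
have [/= hu hv] := sum_diff_trapped (planar_solution_sum_diff sol tT) t0.
case: p (z t) (z 0) p0 hu hv => [x0 y0] [x y] [x1 y1] /= e hu hv.
set d := `|(x1, y1) - (x0, y0)|.
have [d1 d2] : `|x1 - x0| <= d /\ `|y1 - y0| <= d.
  by rewrite /d prod_normE /= !le_max !lexx orbT.
rewrite prod_normE /= ge_max.
have hu1 : `|x1 + y1| <= 2 * d.
  rewrite (_ : x1 + y1 = (x1 - x0) + (y1 - y0)); last by lra.
  by rewrite (le_trans (ler_normD _ _)) //; lra.
have {}hu := le_trans hu hu1.
have {}hv : `|x - y - (x1 - y1)| <= 3 * d by lra.
move: d1 d2 hu hv hu1; rewrite !ler_norml.
move=> /andP[? ?] /andP[? ?] /andP[? ?] /andP[? ?] /andP[? ?].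
by apply/andP; split; apply/andP; split; lra.
Qed.

(** * Explicit orbits and global existence *)

(** The curve (u, v) follows the vector field divided by h: it becomes a
    solution once its parameter y is made to run with speed h(y). *)
Definition orbit_with_clock (R : realType) (u v h : R -> R) :=
  forall y : R, [/\ 0 < h y,
    is_derive y 1 u (- (u y * (u y ^+ 2 + 2 * v y ^+ 2) / 2) / h y) &
    is_derive y 1 v (- (3 / 2 * u y ^+ 2 * v y) / h y)].

Lemma interpolation_gt0 (R : realType) (a e : R) :
  0 <= a <= 1 -> 0 < e -> 0 < 1 - a + a * e.
Proof.
move=> /andP[a0]; rewrite le_eqVlt => /predU1P[->|a1] e0.
  by rewrite subrr add0r mul1r.
by rewrite ltr_pwDl ?subr_gt0 // mulr_ge0 // ltW.
Qed.

Lemma interpolation_le1 (R : realType) (a e : R) :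
  0 <= a -> e <= 1 -> 1 - a + a * e <= 1.
Proof. by move=> a0 e1; nra. Qed.

Lemma sqr_itv01 (R : realType) (k : R) : `|k| <= 1 -> 0 <= k ^+ 2 <= 1.
Proof.
by move=> k1; rewrite sqr_ge0 /= -real_normK ?num_real // expr_le1.
Qed.

Lemma sqrt_le1 (R : realType) (e : R) : e <= 1 -> Num.sqrt e <= 1.
Proof. by move=> e1; rewrite -sqrtr1 ler_wsqrtr. Qed.

Lemma is_derive_expRNid (R : realType) (c y : R) :
  is_derive y 1 (fun s => expR (- (c * s))) (- c * expR (- (c * y))).
Proof.
have d : is_derive y 1 (- (c \*: (id : R -> R))) (- c).
  by apply: is_derive_eq; rewrite /GRing.scale /= mulr1.
apply: (is_derive_eq (is_derive1_comp (is_derive_expR _) d)).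
by rewrite mulrC.
Qed.

Lemma is_derive_sqrt_comp (R : realType) (f : R -> R) (y d : R) :
  0 < f y -> is_derive y 1 f d ->
  is_derive y 1 (fun s => Num.sqrt (f s)) (d / (2 * Num.sqrt (f y))).
Proof.
move=> f0 df; apply: (is_derive_eq (is_derive1_comp (is_derive1_sqrt f0) df)).
by rewrite mulrC.
Qed.

(** With h = v^2 the squared ratio r = u^2 / v^2 satisfies r' = 2 r (r - 1), a
    logistic equation.  For r(0) = k^2 this gives, with p = e^{- y} and
    E = 1 - k^2 + k^2 p^2, the orbit u = k b p E^{1/4}, v = b E^{3/4}.  The
    condition |k| <= 1 keeps E positive for every real y. *)
Lemma orbit_diff_dominant (R : realType) (k b : R) :
  `|k| <= 1 -> b != 0 -> exists u v h : R -> R,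
  [/\ u 0 = k * b, v 0 = b, orbit_with_clock u v h,
   continuous h & forall y, 0 <= y -> h y <= b ^+ 2].
Proof.
move=> /sqr_itv01 k1 b0; have [k_ge0 _] := andP k1.
pose p (y : R) := expR (- (1 * y)).
pose E (y : R) := 1 - k ^+ 2 + k ^+ 2 * (p y * p y).
pose m (y : R) := Num.sqrt (E y).
pose q (y : R) := Num.sqrt (m y).
have p0 y : 0 < p y by exact: expR_gt0.
have E0 y : 0 < E y by apply: interpolation_gt0 => //; exact: mulr_gt0.
have m0 y : 0 < m y by rewrite sqrtr_gt0.
have q0 y : 0 < q y by rewrite sqrtr_gt0.
have qn0 y : q y != 0 by rewrite gt_eqF.
have qm y : m y = q y ^+ 2 by rewrite sqr_sqrtr // ltW.
have dp (y : R) : is_derive y 1 p (- p y).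
  by apply: (is_derive_eq (is_derive_expRNid 1 y)); rewrite mulN1r.
have dE (y : R) : is_derive y 1 E (- 2 * k ^+ 2 * p y ^+ 2).
  have dpy := dp y.
  have : is_derive y 1 (cst (1 - k ^+ 2) + (k ^+ 2) \*: (p * p))
    (- 2 * k ^+ 2 * p y ^+ 2).
    by apply: is_derive_eq; rewrite /GRing.scale /= ?fctE; ring.
  by [].
have dq (y : R) : is_derive y 1 q (- (k ^+ 2 * p y ^+ 2) / (2 * q y ^+ 3)).
  apply: (is_derive_eq
    (is_derive_sqrt_comp (m0 y) (is_derive_sqrt_comp (E0 y) (dE y)))).
  by rewrite -/(m y) -/(q y) qm; field.
have dv (y : R) : is_derive y 1 (b \*: (q * q * q))
    (- (3 / 2 * k ^+ 2 * b * p y ^+ 2 / q y)).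
  by have dqy := dq y; apply: is_derive_eq; rewrite /GRing.scale /= ?fctE; field.
pose v (y : R) := b * (q y * q y * q y).
exists (fun y => k * b * (p y * q y)), v, (fun y => v y * v y).
have q_le1 y : 0 <= y -> q y <= 1.
  move=> y0; apply/sqrt_le1/sqrt_le1/interpolation_le1 => //.
  by rewrite mulr_ile1 ?(ltW (p0 y)) // -expR0 ler_expR oppr_le0 mul1r.
have p00 : p 0 = 1 by rewrite /p mulr0 oppr0 expR0.
have q00 : q 0 = 1 by rewrite /q /m /E p00 !mulr1 subrK !sqrtr1.
split.
- by rewrite p00 q00 !mulr1.
- by rewrite /v q00 !mulr1.
- move=> y; have dpy := dp y; have dqy := dq y; split.
  + by rewrite -expr2 exprn_even_gt0 //= !mulf_neq0.
  + have : is_derive y 1 ((k * b) \*: (p * q))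
      (k * b * (- p y * q y - p y * (k ^+ 2 * p y ^+ 2) / (2 * q y ^+ 3))).
      by apply: is_derive_eq; rewrite /GRing.scale /= ?fctE; field.
    move/is_derive_eq; apply; rewrite /v; field; by rewrite qn0 b0.
  + apply: (is_derive_eq (dv y)); rewrite /v; field; by rewrite qn0 b0.
- have cv : continuous v.
    move=> y; apply/differentiable_continuous/derivable1_diffP.
    by case: (dv y).
  by move=> y; apply: cvgM; exact: cv.
- move=> y y0; rewrite /v -!expr2 -exprSr exprMn ler_piMr ?sqr_ge0 //.
  by rewrite !exprn_ile1 ?exprn_ge0 ?(ltW (q0 y)) // q_le1.
Qed.

(** With h = u^2 the squared ratio s = v^2 / u^2 satisfies s' = - 2 s (1 - s).
    For s(0) = k^2 this gives, with p = e^{- y / 2} and E = 1 - k^2 + k^2 p^4,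
    the orbit u = a p E^{1/2}, v = k a p^3. *)
Lemma orbit_sum_dominant (R : realType) (k a : R) :
  `|k| <= 1 -> a != 0 -> exists u v h : R -> R,
  [/\ u 0 = a, v 0 = k * a, orbit_with_clock u v h,
   continuous h & forall y, 0 <= y -> h y <= a ^+ 2].
Proof.
move=> /sqr_itv01 k1 a0; have [k_ge0 _] := andP k1.
pose p (y : R) := expR (- (2^-1 * y)).
pose E (y : R) := 1 - k ^+ 2 + k ^+ 2 * (p y * p y * (p y * p y)).
pose q (y : R) := Num.sqrt (E y).
have p0 y : 0 < p y by exact: expR_gt0.
have E0 y : 0 < E y by apply: interpolation_gt0 => //; rewrite !mulr_gt0.
have q0 y : 0 < q y by rewrite sqrtr_gt0.
have pn0 y : p y != 0 by rewrite gt_eqF.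
have qn0 y : q y != 0 by rewrite gt_eqF.
have qE y : q y ^+ 2 = E y by rewrite sqr_sqrtr // ltW.
have dp (y : R) : is_derive y 1 p (- (p y / 2)).
  by apply: (is_derive_eq (is_derive_expRNid _ y)); rewrite mulNr mulrC.
have dE (y : R) : is_derive y 1 E (- 2 * k ^+ 2 * p y ^+ 4).
  have dpy := dp y.
  have : is_derive y 1 (cst (1 - k ^+ 2) + (k ^+ 2) \*: (p * p * (p * p)))
    (- 2 * k ^+ 2 * p y ^+ 4).
    by apply: is_derive_eq; rewrite /GRing.scale /= ?fctE; field.
  by [].
have dq (y : R) : is_derive y 1 q (- (k ^+ 2 * p y ^+ 4) / q y).
  apply: (is_derive_eq (is_derive_sqrt_comp (E0 y) (dE y))).
  by rewrite -/(q y); field.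
have du (y : R) : is_derive y 1 (a \*: (p * q))
    (- (a * p y * (q y ^+ 2 + 2 * k ^+ 2 * p y ^+ 4) / (2 * q y))).
  have dpy := dp y; have dqy := dq y.
  by apply: is_derive_eq; rewrite /GRing.scale /= ?fctE; field.
pose u (y : R) := a * (p y * q y).
exists u, (fun y => k * a * (p y * p y * p y)), (fun y => u y * u y).
have p_le1 y : 0 <= y -> p y <= 1.
  by move=> y0; rewrite -expR0 ler_expR oppr_le0 mulr_ge0.
have q_le1 y : 0 <= y -> q y <= 1.
  move=> y0; apply/sqrt_le1/interpolation_le1 => //.
  by rewrite !mulr_ile1 ?mulr_ge0 ?(ltW (p0 y)) // p_le1.
have p00 : p 0 = 1 by rewrite /p mulr0 oppr0 expR0.
have q00 : q 0 = 1 by rewrite /q /E p00 !mulr1 subrK sqrtr1.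
split.
- by rewrite /u p00 q00 !mulr1.
- by rewrite p00 !mulr1.
- move=> y; have dpy := dp y; have dqy := dq y; split.
  + by rewrite -expr2 exprn_even_gt0 //= !mulf_neq0.
  + apply: (is_derive_eq (du y)); rewrite /u; field; by rewrite qn0 pn0 a0.
  + have : is_derive y 1 ((k * a) \*: (p * p * p))
      (- (3 / 2 * k * a * p y ^+ 3)).
      by apply: is_derive_eq; rewrite /GRing.scale /= ?fctE; field.
    move/is_derive_eq; apply; rewrite /u; field; by rewrite qn0 pn0 a0.
- have cu : continuous u.
    move=> y; apply/differentiable_continuous/derivable1_diffP.
    by case: (du y).
  by move=> y; apply: cvgM; exact: cu.
- move=> y y0; rewrite /u -!expr2 exprMn ler_piMr ?sqr_ge0 //.
  by rewrite exprn_ile1 ?mulr_ge0 ?mulr_ile1 ?(ltW (q0 y)) ?(ltW (p0 y)) ?p_le1 ?q_le1.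
Qed.

Lemma orbit_with_clock_exists (R : realType) (a b : R) :
  exists (u v h : R -> R) (C : R),
  [/\ u 0 = a, v 0 = b, orbit_with_clock u v h,
   continuous h & forall y, 0 <= y -> h y <= C].
Proof.
have [->|b0] := eqVneq b 0.
  have [->|a0] := eqVneq a 0.
    exists (cst 0), (cst 0), (cst 1), 1; split=> //; last exact: cst_continuous.
    by move=> y; split=> //; apply: is_derive_eq; rewrite /= !(mul0r, mulr0) oppr0 mul0r.
  have [|u [v [h]]] := @orbit_sum_dominant R 0 a _ a0; first by rewrite normr0.
  by rewrite mul0r; exists u, v, h, (a ^+ 2).
have [ab|/ltW ba] := leP `|a| `|b|.
  have [|u [v [h]]] := @orbit_diff_dominant R (a / b) b _ b0.
    by rewrite normrM normfV ler_pdivrMr ?normr_gt0 // mul1r.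
  by rewrite divfK //; exists u, v, h, (b ^+ 2).
have a0 : a != 0 by rewrite -normr_gt0 (lt_le_trans _ ba) ?normr_gt0.
have [|u [v [h]]] := @orbit_sum_dominant R (b / a) a _ a0.
  by rewrite normrM normfV ler_pdivrMr ?normr_gt0 // mul1r.
by rewrite divfK //; exists u, v, h, (a ^+ 2).
Qed.

Lemma planar_solution_exists (R : realType) (q : R * R) :
  exists2 z : R -> R * R, z 0 = q & forward_solution (@planar_field R) +oo%E z.
Proof.
have [u [v [h [C [u0 v0 orb ch hC]]]]] :=
  orbit_with_clock_exists (q.1 + q.2) (q.1 - q.2).
have h0 y : 0 < h y by case: (orb y).
have [y y0 dy] := autonomous_ode_solvable ch h0 hC.
pose z t := (2^-1 * (u (y t) + v (y t)), 2^-1 * (u (y t) - v (y t))).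
have dz (t : R) : 0 <= t -> is_derive t 1 z (planar_field (z t)).
  move=> t0; have [_ du dv] := orb (y t); have dyt := dy t t0.
  have hn0 : h (y t) != 0 by rewrite gt_eqF.
  have duy := is_derive1_comp du dyt; have dvy := is_derive1_comp dv dyt.
  rewrite !divfK // in duy dvy.
  have dz1 := is_deriveZ 2^-1 (is_deriveD duy dvy).
  have dz2 := is_deriveZ 2^-1 (is_deriveB duy dvy).
  apply: (is_derive_eq (is_derive_pair dz1 dz2)).
  by rewrite planar_fieldE /GRing.scale /=; congr pair; field.
exists z.
  by rewrite /z y0 u0 v0 [RHS]surjective_pairing; congr pair; field.
split.
  apply: continuous_in_subspaceT => t; rewrite inE /= => -[t0 _].
  apply/differentiable_continuous/derivable1_diffP.
  by case: (dz t t0).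
by move=> t t0 _; apply: dz; exact: ltW.
Qed.

(** * Lyapunov stability *)

Theorem proposition4p8 (R : realType) (p0 : R * R)
    (hp0 : planar_field p0 = 0) : lyapunov_stable (@planar_field R) p0.
Proof.
move=> eps eps0; exists (eps / 4); first exact: divr_gt0.
move=> q qp; split; first exact: planar_solution_exists.
move=> T z z0 sol t t0 tT.
have := planar_solution_stable hp0 sol t0 tT; rewrite z0 => le4.

apply: (le_lt_trans le4).
by rewrite mulrC -ltr_pdivlMr.
Qed.
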